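(* Let $k$ be a field with $u(k)\leq 2$ which is not quadratically closed, with $\mathrm{char}(k)\neq 2$ and $|k|\geq 5$. Let $G:=\mathrm{SL}_2(k)$ and let $\mathscr{C}_1$ and $\mathscr{C}_2$ be two distinct semisimple conjugacy classes in $G$. (1) If $\mathrm{tr}(\mathscr{C}_1)\neq -\mathrm{tr}(\mathscr{C}_2)$, then $\mathscr{C}_1\mathscr{C}_2=G\setminus \{\pm I\}$. (2) If $\mathrm{tr}(\mathscr{C}_1)=-\mathrm{tr}(\mathscr{C}_2)$, then $\mathscr{C}_1\mathscr{C}_2=G\setminus \{I\}$ unless $\mathscr{C}_1$ and $\mathscr{C}_2$ are both non-split semisimple, in which case $\mathscr{C}_1\mathscr{C}_2=G\setminus (\{I\}\cup\{\text{negative unipotent elements}\})$.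
   Context: A field $k$ has $u(k)\leq 2$ if every quadratic form in $3$ variables over $k$ is isotropic. A field is quadratically closed if it admits no quadratic extension. A semisimple class means a non-central semisimple conjugacy class; it is non-split if the characteristic polynomial of its elements is irreducible over $k$, and split otherwise. A negative unipotent element is one with minimal polynomial $(X+1)^2$ (so $-I$ is not counted). $\mathrm{tr}(\mathscr{C})$ is the common trace of the elements of $\mathscr{C}$. $\mathscr{C}_1\mathscr{C}_2=\{xy:x\in\mathscr{C}_1,y\in\mathscr{C}_2\}$. *)

(* Defs.v *)
From HB Require Import structures.
From mathcomp Require Import all_boot all_order all_fingroup all_algebra all_field.
From mathcomp Require Import boolp classical_sets functions cardinality.
Set Implicit Arguments.
Unset Strict Implicit.
Unset Printing Implicit Defensive.
Import GRing.Theory.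
Local Open Scope classical_set_scope.
Local Open Scope ring_scope.

(* A quadratic form in n variables over k is given by an arbitrary n x n matrix
   A (not necessarily symmetric), so this covers all forms, also in
   characteristic 2; 'v |-> v A v^T' is its value. *)
Definition isotropic (k : fieldType) (n : nat) (A : 'M[k]_n) : Prop :=
  exists2 v : 'rV[k]_n, v != 0 & v *m A *m v^T = 0.

Definition u_le2 (k : fieldType) : Prop := forall A : 'M[k]_3, isotropic A.

Definition quadratically_closed (k : fieldType) : Prop :=
  ~ exists L : fieldExtType k, \dim {:L} = 2.

Section SpecialLinearGroup.
Variables (n : nat) (k : fieldType).

Record SL : predArgType := MkSL { SLval : 'M[k]_n; _ : \det SLval == 1 }.

HB.instance Definition _ := [isSub for SLval].
HB.instance Definition _ := [Choice of SL by <:].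

Lemma SL_det (x : SL) : \det (\val x) = 1.
Proof. by case: x => A /= /eqP. Qed.

Lemma SL_unitmx (x : SL) : \val x \in unitmx.
Proof. by rewrite unitmxE SL_det unitr1. Qed.

Fact SL_mul_subproof (x y : SL) : \det (\val x *m \val y) == 1.
Proof. by rewrite det_mulmx !SL_det mulr1. Qed.

Fact SL_one_subproof : \det (1%:M : 'M[k]_n) == 1.
Proof. by rewrite det1. Qed.

Fact SL_inv_subproof (x : SL) : \det (invmx (\val x)) == 1.
Proof. by rewrite det_inv SL_det invr1. Qed.

Definition SL_mul (x y : SL) : SL := MkSL (SL_mul_subproof x y).
Definition SL_one : SL := MkSL SL_one_subproof.
Definition SL_inv (x : SL) : SL := MkSL (SL_inv_subproof x).

Fact SL_mulA : associative SL_mul.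
Proof. by move=> x y z; apply: val_inj; rewrite /= mulmxA. Qed.

Fact SL_mul1g : left_id SL_one SL_mul.
Proof. by move=> x; apply: val_inj; rewrite /= mul1mx. Qed.

Fact SL_mulg1 : right_id SL_one SL_mul.
Proof. by move=> x; apply: val_inj; rewrite /= mulmx1. Qed.

Fact SL_mulVg : left_inverse SL_one SL_inv SL_mul.
Proof. by move=> x; apply: val_inj; rewrite /= mulVmx ?SL_unitmx. Qed.

Fact SL_mulgV : right_inverse SL_one SL_inv SL_mul.
Proof. by move=> x; apply: val_inj; rewrite /= mulmxV ?SL_unitmx. Qed.

HB.instance Definition _ :=
  isGroup.Build SL SL_mulA SL_mul1g SL_mulg1 SL_mulVg SL_mulgV.

End SpecialLinearGroup.

Fact SL2_opp1_subproof (k : fieldType) : \det (- 1%:M : 'M[k]_2) == 1.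
Proof. by rewrite -scaleN1r detZ det1 mulr1 expr2 mulrNN mulr1. Qed.

Definition SL2_opp1 (k : fieldType) : SL 2 k := MkSL (SL2_opp1_subproof k).

Definition conjugacy_class (G : groupType) (g : G) : set G :=
  [set (g ^ h)%g | h in [set: G]].

Definition central (G : groupType) (g : G) : Prop := forall h : G, commute g h.

(* Diagonalizable over some extension field of k is the same as diagonalizable
   over an algebraic closure of k, since the eigenvalues are algebraic over k. *)
Definition semisimple (n : nat) (k : fieldType) (g : SL n k) : Prop :=
  exists (K : fieldType) (iota : {rmorphism k -> K}),
    diagonalizable (map_mx iota (\val g)).

Definition semisimple_class (k : fieldType) (C : set (SL 2 k)) : Prop :=
  exists g : SL 2 k,
    [/\ ~ central g, semisimple g & C = conjugacy_class g].

Definition nonsplit (k : fieldType) (C : set (SL 2 k)) : Prop :=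
  forall x, C x -> irreducible_poly (char_poly (\val x)).

(* Meaningful when C is nonempty and the trace is constant on C; see
   class_traceE. *)
Definition class_trace (k : fieldType) (C : set (SL 2 k)) : k :=
  xget 0 [set \tr (\val x) | x in C].

Lemma class_traceE (k : fieldType) (g x : SL 2 k) :
  conjugacy_class g x -> class_trace (conjugacy_class g) = \tr (\val x).
Proof.
have trJ y : conjugacy_class g y -> \tr (\val y) = \tr (\val g).
  by case=> h _ <- /=; rewrite mxtrace_mulC -mulmxA mulmxV ?SL_unitmx ?mulmx1.
move=> Cx; rewrite /class_trace.
have [y Cy <-] := @xgetPex _ 0 [set \tr (\val y) | y in conjugacy_class g]
  (ex_intro _ _ (ex_intro2 _ _ x Cx erefl)).
by rewrite !trJ.
Qed.

Definition class_prod (G : groupType) (C1 C2 : set G) : set G :=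
  [set (x * y)%g | x in C1 & y in C2].

Definition negative_unipotent (k : fieldType) : set (SL 2 k) :=
  [set x | mxminpoly (\val x) = ('X + 1) ^+ 2].
Arguments negative_unipotent : clear implicits.

(* Main.v *)
Require Import Defs.
From HB Require Import structures.
From mathcomp Require Import all_boot all_order all_fingroup all_algebra all_field.
From mathcomp Require Import boolp classical_sets functions cardinality.
From mathcomp Require Import ring.
Set Implicit Arguments.
Unset Strict Implicit.
Unset Printing Implicit Defensive.
Import GRing.Theory.
Local Open Scope classical_set_scope.
Local Open Scope ring_scope.

(** If u(k) <= 2, every nondegenerate binary quadratic form is universal. For A
    in SL_2(k) the form v |-> det (v; v A) has discriminant tr(A)^2 - 4, so when
    tr(A)^2 <> 4 it takes the value 1, and A is conjugate to its companion matrix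
    already in SL_2(k): a semisimple class is the set of all elements of its
    trace. Hence g is a product x y with traces t1, t2 iff some x of determinant
    1 and trace t1 satisfies tr(x^-1 g) = t2. For non-scalar g of trace t, put in
    companion form, this is the affine conic
    p^2 + t p q + q^2 - t1 p - t2 q + 1 = 0. It always has a point if t^2 <> 4 by
    universality, and if t = 2, being then a parabola; for t = -2 the only
    obstruction is when t1 = - t2 and X^2 - t1 X + 1 has no root. *)

(** * Two-by-two matrices and companion form *)

Definition mx22 (R : Type) (a b c d : R) : 'M[R]_2 :=
  \matrix_(i, j) if i == 0 then if j == 0 then a else b
                 else if j == 0 then c else d.

Lemma mx22P (R : Type) (A : 'M[R]_2) : exists a b c d, A = mx22 a b c d.
Proof.
exists (A 0 0), (A 0 1), (A 1 0), (A 1 1); apply/matrixP => i j; rewrite mxE.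
by case: i j => [[|[|//]] lti] [[|[|//]] ltj] /=; congr (A _ _); apply: val_inj.
Qed.

Lemma map_mx22 (R S : Type) (f : R -> S) a b c d :
  map_mx f (mx22 a b c d) = mx22 (f a) (f b) (f c) (f d).
Proof. by apply/matrixP => i j; rewrite !mxE; do 2 case: (_ == 0). Qed.

Section Matrix22.
Variable R : comNzRingType.
Implicit Types (a b c d : R) (A : 'M[R]_2).

Lemma mx22_mul a b c d a' b' c' d' :
  mx22 a b c d *m mx22 a' b' c' d' =
  mx22 (a * a' + b * c') (a * b' + b * d') (c * a' + d * c') (c * b' + d * d').
Proof.
apply/matrixP => i j; rewrite !mxE !big_ord_recl big_ord0 addr0 !mxE /=.
by case: (i == 0); case: (j == 0).
Qed.

Lemma mx22_det a b c d : \det (mx22 a b c d) = a * d - b * c.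
Proof.
rewrite (expand_det_row _ 0) !big_ord_recl big_ord0 /cofactor !det_mx11.
by rewrite !mxE /= /bump /=; ring.
Qed.

Lemma mx22_tr a b c d : \tr (mx22 a b c d) = a + d.
Proof. by rewrite /mxtrace !big_ord_recl big_ord0 !mxE /= addr0. Qed.

Lemma mx22_scalar a : a%:M = mx22 a 0 0 a.
Proof. by apply/matrixP => -[[|[|//]] ?] [[|[|//]] ?]; rewrite !mxE. Qed.

Lemma mx22_is_scalar a b c d :
  is_scalar_mx (mx22 a b c d) -> [/\ a = d, b = 0 & c = 0].
Proof.
case/is_scalar_mxP=> e /matrixP E.
move: (E 0 0) (E 0 1) (E 1 0) (E 1 1); rewrite !mxE /= => -> -> -> ->.
by split.
Qed.

Lemma mx22_Cayley_Hamilton A :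
  A *m ((\tr A)%:M - A) = (\det A)%:M.
Proof.
have [a [b [c [d ->]]]] := mx22P A.
rewrite mx22_tr mx22_det mulmxBr !mx22_scalar !mx22_mul.
by apply/matrixP => i j; rewrite !mxE; do 2 case: (_ == 0); ring.
Qed.

(** Multiplication by X on R[X]/(X^2 - t X + 1) in the basis 1, X, acting on row vectors. *)
Definition companion22 (t : R) : 'M[R]_2 := mx22 0 1 (- 1) t.

Lemma companion22_det t : \det (companion22 t) = 1.
Proof. by rewrite mx22_det; ring. Qed.

(* The rows are v and v A for v = (x, y). *)
Definition cyclic22 (x y : R) (A : 'M[R]_2) : 'M[R]_2 :=
  mx22 x y (x * A 0 0 + y * A 1 0) (x * A 0 1 + y * A 1 1).

(** With v = (x, y), the second rows agree by Cayley-Hamilton: v A^2 = tr(A) v A - v as det A =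
    1. *)
Lemma cyclic22_companion x y A :
  \det A = 1 -> cyclic22 x y A *m A = companion22 (\tr A) *m cyclic22 x y A.
Proof.
have [a [b [c [d ->]]]] := mx22P A.
rewrite mx22_tr /cyclic22 /companion22 !mx22_mul mx22_det !mxE /= => D.
by congr mx22; (ring || rewrite -D; ring).
Qed.

Lemma cyclic22_det x y a b c d :
  \det (cyclic22 x y (mx22 a b c d)) =
  b * x ^+ 2 + (d - a) * x * y + (- c) * y ^+ 2.
Proof. by rewrite mx22_det !mxE /=; ring. Qed.

Lemma mx22_companion_tr p q r s t :
  \tr (mx22 p q r s *m companion22 t) = r - q + t * s.
Proof. by rewrite mx22_mul mx22_tr; ring. Qed.

End Matrix22.

Lemma mx22_char_poly (R : comNzRingType) (A : 'M[R]_2) :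
  char_poly A = 'X^2 - \tr A *: 'X + (\det A)%:P.
Proof.
have [a [b [c [d ->]]]] := mx22P A.
have -> : char_poly (mx22 a b c d) =
    \det (mx22 ('X - a%:P) (- b%:P) (- c%:P) ('X - d%:P)).
  congr (\det _); apply/matrixP => i j; rewrite !mxE.
  by case: i j => [[|[|//]] ?] [[|[|//]] ?] /=; rewrite ?mulr1n ?mulr0n ?sub0r.
rewrite !mx22_det mx22_tr -mul_polyC polyCB polyCD !polyCM.
ring.
Qed.

(** * Universality of binary quadratic forms *)

(** Adjoin the term - e z^2. An isotropic vector with z nonzero gives a solution after division by
    z; if z = 0, the binary form is itself isotropic, which makes it universal. *)
Lemma u_le2_binary_universal (k : fieldType) (a b c e : k) :
    u_le2 k -> b ^+ 2 - 4 * a * c != 0 -> e != 0 ->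
  exists x y, a * x ^+ 2 + b * x * y + c * y ^+ 2 = e.
Proof.
move=> hu disc ne0.
pose A : 'M[k]_3 := \matrix_(i, j)
  (nth [::] [:: [:: a; b; 0]; [:: 0; c; 0]; [:: 0; 0; - e]] i)`_j.
have [v vN0 Av] := hu A.
pose x := v 0 0; pose y := v 0 1; pose z := v 0 (lift 0 1).
have vE : a * x ^+ 2 + b * x * y + c * y ^+ 2 = e * z ^+ 2.
  move/matrixP/(_ 0 0): Av.
  rewrite !mxE !big_ord_recl big_ord0 !mxE !big_ord_recl !big_ord0 !mxE /=.
  have -> : lift 0 ord0 = 1 :> 'I_3 by apply: val_inj.
  have -> : lift 0 (lift 0 ord0) = lift 0 1 :> 'I_3 by apply: val_inj.
  rewrite -/x -/y -/z => E; apply/eqP; rewrite -subr_eq0 -[X in _ == X]E.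
  by apply/eqP; ring.
have [z0|zN0] := eqVneq z 0; last first.
  exists (x / z), (y / z).
  have -> : e = e * z ^+ 2 / z ^+ 2 by field.
  by rewrite -vE; field.
have {}vE : a * x ^+ 2 + b * x * y + c * y ^+ 2 = 0.
  by rewrite vE z0 expr0n mulr0.
have xyN0 : (x != 0) || (y != 0).
  apply: contraR vN0; rewrite negb_or !negbK => /andP[/eqP x0 /eqP y0].
  apply/eqP/rowP => -[[|[|[|//]]] lti]; rewrite mxE.
  - by rewrite -x0; congr (v _ _); apply: val_inj.
  - by rewrite -y0; congr (v _ _); apply: val_inj.
  - by rewrite -z0; congr (v _ _); apply: val_inj.
(* The form is isotropic: it is linear with nonzero slope along a line in the
   direction (x, y) through a vector not orthogonal to it. *)
have [B1|B1] := eqVneq (2 * a * x + b * y) 0; last first.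
  pose s := (e - a) / (2 * a * x + b * y).
  exists (s * x + 1), (s * y).
  transitivity (s ^+ 2 * (a * x ^+ 2 + b * x * y + c * y ^+ 2)
                + s * (2 * a * x + b * y) + a); first by ring.
  by rewrite vE /s; field.
have [B2|B2] := eqVneq (b * x + 2 * c * y) 0; last first.
  pose s := (e - c) / (b * x + 2 * c * y).
  exists (s * x), (s * y + 1).
  transitivity (s ^+ 2 * (a * x ^+ 2 + b * x * y + c * y ^+ 2)
                + s * (b * x + 2 * c * y) + c); first by ring.
  by rewrite vE /s; field.
(* Both partial derivatives vanish at (x, y). This linear system has determinant minus the
   discriminant, which forces x = y = 0. *)
have Dx : (b ^+ 2 - 4 * a * c) * x = 0.
  transitivity (b * (b * x + 2 * c * y) - 2 * c * (2 * a * x + b * y)).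
    by ring.
  by rewrite B1 B2; ring.
have Dy : (b ^+ 2 - 4 * a * c) * y = 0.
  transitivity (b * (2 * a * x + b * y) - 2 * a * (b * x + 2 * c * y)).
    by ring.
  by rewrite B1 B2; ring.
case/orP: xyN0 => N0; [have := Dx | have := Dy];
  by move/eqP; rewrite mulf_eq0 (negPf disc) (negPf N0).
Qed.

(** * Semisimple classes of SL_2 and their traces *)

Section SL2.
Variable k : fieldType.
Implicit Types (g h x : SL 2 k) (C : set (SL 2 k)).
Local Notation tr g := (\tr (\val g)).

Lemma SL_mulE g h : \val (g * h)%g = \val g *m \val h.
Proof. by []. Qed.

Lemma SL2_exists (A : 'M[k]_2) : \det A = 1 -> exists x, \val x = A.
Proof. by move/eqP=> D; exists (MkSL D). Qed.

Lemma SL2_valV g : \val (g^-1)%g = (tr g)%:M - \val g.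
Proof.
apply: (can_inj (mulKmx (SL_unitmx g))).
by rewrite mx22_Cayley_Hamilton SL_det -SL_mulE mulgV.
Qed.

Lemma SL2_trJ g h : tr (g ^ h)%g = tr g.
Proof. by rewrite /= mxtrace_mulC -mulmxA mulmxV ?SL_unitmx ?mulmx1. Qed.

Lemma SL2_scalar g : is_scalar_mx (\val g) -> g = 1%g \/ g = SL2_opp1 k.
Proof.
move=> /is_scalar_mxP[a ga].
have : a ^+ 2 - 1 ^+ 2 == 0.
  by move: (SL_det g); rewrite ga det_scalar => ->; rewrite expr1n subrr.
rewrite subr_sqr mulf_eq0 subr_eq0 addr_eq0 => /orP[]/eqP aE; [left|right];
  by apply: val_inj; rewrite ga aE //= rmorphN.
Qed.

Lemma scalar_central g : is_scalar_mx (\val g) -> central g.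
Proof.
move=> /is_scalar_mxP[a ga] h; apply: val_inj.
by rewrite !SL_mulE ga scalar_mxC.
Qed.

(** Over [K] the difference of the two eigenvalues squares to tr^2 - 4. If this vanishes, a
    diagonalizable matrix is scalar, and g is central. *)
Lemma semisimple_tr_neq g :
  ~ central g -> semisimple g -> tr g ^+ 2 - 4 != 0.
Proof.
move=> ncg [K [f [P Pu /similar_diagPex[D /(similarP Pu) PD]]]].
apply/eqP => t0; apply: ncg; apply: scalar_central.
have [a [b [c [d gE]]]] := mx22P (\val g).
have fgE : map_mx f (\val g) = invmx P *m diag_mx D *m P.
  by rewrite -mulmxA -PD mulKmx.
have trD : f (tr g) = D 0 0 + D 0 1.
  rewrite -trace_map_mx fgE mxtrace_mulC mulmxA mulmxV ?mul1mx //.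
  rewrite mxtrace_diag !big_ord_recl big_ord0 addr0.
  by congr (_ + D _ _); apply: val_inj.
have detD : 1 = D 0 0 * D 0 1.
  rewrite -[1](rmorph1 f) -(SL_det g) -det_map_mx fgE !det_mulmx.
  rewrite mulrAC -det_mulmx mulVmx // det1 mul1r.
  rewrite det_diag !big_ord_recl big_ord0 mulr1.
  by congr (_ * D _ _); apply: val_inj.
have D01 : D 0 0 = D 0 1.
  apply/eqP; rewrite -subr_eq0 -sqrf_eq0; apply/eqP.
  transitivity ((D 0 0 + D 0 1) ^+ 2 - 4 * (D 0 0 * D 0 1)); first by ring.
  by rewrite -trD -detD -rmorphXn mulr1 -[RHS](rmorph0 f) -t0 rmorphB rmorph_nat.
have : is_scalar_mx (map_mx f (\val g)).
  suff -> : map_mx f (\val g) = (D 0 0)%:M by apply: scalar_mx_is_scalar.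
  rewrite fgE; suff -> : diag_mx D = (D 0 0)%:M.
    by rewrite -mulmxA mul_scalar_mx -scalemxAr mulVmx // scalemx1.
  apply/matrixP => -[[|[|//]] lti] j; rewrite !mxE; congr (_ *+ _).
    by congr (D _ _); apply: val_inj.
  by rewrite D01; congr (D _ _); apply: val_inj.
rewrite gE map_mx22 => /mx22_is_scalar[/fmorph_inj -> /eqP + /eqP].
by rewrite !fmorph_eq0 => /eqP-> /eqP->; rewrite -mx22_scalar scalar_mx_is_scalar.
Qed.

Lemma SL2_conj_companion g : u_le2 k -> tr g ^+ 2 - 4 != 0 ->
  exists P : SL 2 k, \val (g ^ P^-1)%g = companion22 (tr g).
Proof.
move=> hu disc; have [a [b [c [d gE]]]] := mx22P (\val g).
have {}disc : (d - a) ^+ 2 - 4 * b * - c != 0.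
  have -> : (d - a) ^+ 2 - 4 * b * - c = (a + d) ^+ 2 - 4 * (a * d - b * c) by ring.
  by rewrite -(mx22_det a b c d) -(mx22_tr a b c d) -gE SL_det mulr1.
(* The value 1 puts the conjugating matrix in SL_2 and not only in GL_2. *)
have [x [y e1]] := u_le2_binary_universal hu disc (oner_neq0 k).
have [P PE] : exists P : SL 2 k, \val P = cyclic22 x y (\val g).
  by apply: SL2_exists; rewrite gE cyclic22_det.
exists P; rewrite conjgE invgK !SL_mulE PE mulmxA cyclic22_companion ?SL_det //.
by rewrite -mulmxA -PE mulmxV ?SL_unitmx ?mulmx1.
Qed.

Lemma SL2_conj_tr g h : u_le2 k -> tr g ^+ 2 - 4 != 0 -> tr g = tr h ->
  conjugacy_class g h.
Proof.
move=> hu disc gh; have [P gP] := SL2_conj_companion hu disc.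
have [Q hQ] : exists Q : SL 2 k, \val (h ^ Q^-1)%g = companion22 (tr h).
  by apply: SL2_conj_companion; rewrite -?gh.
exists (P^-1 * Q)%g => //; rewrite conjgM.
have -> : (g ^ P^-1 = h ^ Q^-1)%g by apply: val_inj; rewrite gP hQ gh.
exact: conjgKV.
Qed.

Lemma semisimple_classP C : u_le2 k -> semisimple_class C ->
  C = [set x | tr x = class_trace C] /\ class_trace C ^+ 2 - 4 != 0.
Proof.
move=> hu [g [ncg ssg ->]].
have gg : conjugacy_class g g by exists 1%g; rewrite ?conjg1.
have disc := semisimple_tr_neq ncg ssg; rewrite (class_traceE gg); split => //.
apply/seteqP; split => [_ [h _ <-]|h /= gh]; first exact: SL2_trJ.
exact: SL2_conj_tr.
Qed.

(** * Products of classes as points of a conic *)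

(** GL_2 suffices here, since its conjugation preserves traces and determinants. For non-scalar g
    the form of [cyclic22_det] is nonzero at one of (1, 0), (0, 1), (1, 1). *)
Lemma SL2_conj_companion_GL g : ~~ is_scalar_mx (\val g) ->
  exists2 P, P \in unitmx & P *m \val g = companion22 (tr g) *m P.
Proof.
have [a [b [c [d gE]]]] := mx22P (\val g) => nsc.
suff [x [y xy0]] : exists x y : k, \det (cyclic22 x y (\val g)) != 0.
  exists (cyclic22 x y (\val g)); first by rewrite unitmxE unitfE.
  by rewrite cyclic22_companion ?SL_det.
rewrite gE; have [b0|bN0] := eqVneq b 0; last first.
  by exists 1, 0; rewrite cyclic22_det expr1n expr0n !mulr0 mulr1 !addr0.
have [c0|cN0] := eqVneq c 0; last first.
  by exists 0, 1; rewrite cyclic22_det expr1n expr0n !mulr0 mul0r mulr1 !add0r oppr_eq0.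
exists 1, 1; rewrite cyclic22_det b0 c0 oppr0 !mul0r add0r addr0 !mulr1 subr_eq0.
by apply: contraNneq nsc => da; rewrite gE da b0 c0 -mx22_scalar scalar_mx_is_scalar.
Qed.

(* For g in companion form, the point (p, q) is the first row of the factor in
   the class of trace t1; its second row is determined by the two traces. *)
Lemma tr_class_prodP (t1 t2 : k) g : ~~ is_scalar_mx (\val g) ->
  class_prod [set x : SL 2 k | tr x = t1] [set x | tr x = t2] g <->
  exists p q : k, p ^+ 2 + tr g * p * q + q ^+ 2 - t1 * p - t2 * q + 1 = 0.
Proof.
move=> /SL2_conj_companion_GL[P Pu PgP].
have gE : \val g = invmx P *m companion22 (tr g) *m P by rewrite -mulmxA -PgP mulKmx.
have trM A : \tr (A *m \val g) = \tr (P *m A *m invmx P *m companion22 (tr g)).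
  by rewrite -!mulmxA [RHS]mxtrace_mulC {1}gE !mulmxA.
split=> [[x /= xt1 [y yt2 xyg]]|[p [q pq]]].
  have [p [q [r [s xE]]]] := mx22P (P *m \val x *m invmx P).
  have trx : p + s = t1.
    by rewrite -(mx22_tr p q r s) -xE mxtrace_mulC mulmxA mulVmx // mul1mx.
  have detx : p * s - q * r = 1.
    rewrite -mx22_det -xE !det_mulmx mulrAC -det_mulmx mulmxV // det1 mul1r.
    exact: SL_det.
  (* Since x^-1 = t1 I - x, the trace of y = x^-1 g is t1 tr(g) - tr(x g), affine in the entries of
     x. *)
  have tryg : t1 * tr g - (r - q + tr g * s) = t2.
    rewrite -(mx22_companion_tr p) -xE -trM -yt2.
    have -> : y = (x^-1 * g)%g by rewrite -xyg mulKg.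
    by rewrite SL_mulE SL2_valV mulmxBl raddfB /= mul_scalar_mx mxtraceZ xt1.
  exists p, q; rewrite -tryg -trx -[X in _ + X = 0]detx.
  ring.
(* Once [s] and [r] solve the two trace conditions, the conic equation says that the determinant is
   1. *)
pose s := t1 - p; pose r := t1 * tr g - t2 + q - tr g * s.
have [x xE] : exists x : SL 2 k, \val x = invmx P *m mx22 p q r s *m P.
  apply: SL2_exists; rewrite !det_mulmx mulrAC -det_mulmx mulVmx // det1 mul1r.
  by rewrite mx22_det /r /s -[RHS]subr0 -[X in _ = _ - X]pq; ring.
have xt1 : tr x = t1.
  by rewrite xE mxtrace_mulC mulmxA mulmxV // mul1mx mx22_tr /s subrKC.
exists x => //; exists (x^-1 * g)%g; last by rewrite mulKVg.
change (tr (x^-1 * g)%g = t2).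
rewrite SL_mulE SL2_valV mulmxBl raddfB /= mul_scalar_mx mxtraceZ xt1 trM.
rewrite xE !mulmxA mulmxV // mul1mx mulmxK // mx22_companion_tr /r.
by ring.
Qed.

Lemma conic_point (t t1 t2 : k) : u_le2 k -> (2 : k) != 0 -> t1 != t2 ->
    (t = -2 -> t1 = - t2 -> exists w : k, w ^+ 2 - t1 * w + 1 = 0) ->
  exists p q : k, p ^+ 2 + t * p * q + q ^+ 2 - t1 * p - t2 * q + 1 = 0.
Proof.
move=> hu n2 t12 split.
have [t4|t4] := eqVneq (t ^+ 2 - 4) 0; last first.
  have tN4 : 4 - t ^+ 2 != 0 by rewrite -opprB oppr_eq0.
  (* The centre of the conic: translating to it removes the linear terms and leaves the constant
     [- e]. *)
  pose p0 := (2 * t1 - t * t2) / (4 - t ^+ 2).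
  pose q0 := (2 * t2 - t * t1) / (4 - t ^+ 2).
  pose e := (t1 * p0 + t2 * q0) / 2 - 1.
  suff [u [v uv]] : exists u v : k, u ^+ 2 + t * u * v + v ^+ 2 = e.
    exists (p0 + u), (q0 + v).
    transitivity (u ^+ 2 + t * u * v + v ^+ 2 - e); last by rewrite uv subrr.
    by rewrite /e /p0 /q0; field; rewrite n2 tN4.
  have [->|eN0] := eqVneq e 0; first by exists 0, 0; ring.
  have disc : t ^+ 2 - 4 * 1 * 1 != 0 by rewrite !mulr1.
  have [u [v <-]] := u_le2_binary_universal hu disc eN0.
  by exists u, v; ring.
have : (t - 2) * (t + 2) == 0 by rewrite -t4; apply/eqP; ring.
rewrite mulf_eq0 subr_eq0 addr_eq0 => /orP[]/eqP tE.
  have d0 : t2 - t1 != 0 by rewrite subr_eq0 eq_sym.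
  (* For t = 2 the quadratic part is (p + q)^2, so the line p + q = 0 leaves a linear equation. *)
  by exists (- (t2 - t1)^-1), (t2 - t1)^-1; rewrite tE; field.
(* For t = -2 the quadratic part is (p - q)^2. The line p = q gives a point unless t1 + t2 = 0, when
   a root w gives (w, 0). *)
have [ts|ts] := eqVneq (t1 + t2) 0.
  have [|w w0] := split tE; first by apply/eqP; rewrite -addr_eq0 ts.
  by exists w, 0; rewrite -[RHS]w0; ring.
by exists (t1 + t2)^-1, (t1 + t2)^-1; rewrite tE; field.
Qed.

(** * Non-split classes and negative unipotents *)

Lemma irreducible_quadraticP (t : k) :
  irreducible_poly ('X^2 - t *: 'X + 1%:P) <->
  ~ exists w : k, w ^+ 2 - t * w + 1 = 0.
Proof.
set f := (X in irreducible_poly X).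
have sf : size f = 3.
  rewrite /f -addrA size_polyDl size_polyXn //.
  rewrite (leq_ltn_trans (size_polyD _ _)) // gtn_max size_polyC oner_eq0 andbT.
  by rewrite size_polyN (leq_ltn_trans (size_scale_leq _ _)) ?size_polyX.
have rf w : root f w = (w ^+ 2 - t * w + 1 == 0).
  by rewrite rootE /f !hornerE.
split=> [[_ irr] [w /eqP]|nroot]; last first.
  apply: cubic_irreducible => [|w]; first by rewrite sf.
  by rewrite rf; apply/eqP => w0; apply: nroot; exists w.
rewrite -rf -dvdp_XsubCl => /irr; rewrite size_XsubC => /(_ isT)/eqp_size.
by rewrite size_XsubC sf.
Qed.

(** The minimal polynomial of a non-scalar 2 x 2 matrix has degree 2, so it is the characteristic
    polynomial X^2 - tr(g) X + 1. *)
Lemma negative_unipotentP g :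
  negative_unipotent k g <-> ~~ is_scalar_mx (\val g) /\ tr g = -2.
Proof.
have mp_size : ~~ is_scalar_mx (\val g) -> mxminpoly (\val g) = char_poly (\val g).
  rewrite -mxminpoly_linear_is_scalar -ltnNge => d1.
  apply/eqP; rewrite -eqp_monic ?mxminpoly_monic ?char_poly_monic //.
  rewrite -dvdp_size_eqp ?mxminpoly_dvd_char // eqn_leq.
  rewrite dvdp_leq ?mxminpoly_dvd_char ?monic_neq0 ?char_poly_monic //=.
  by rewrite size_char_poly size_mxminpoly.
have sqE : ('X + 1) ^+ 2 = 'X^2 - (-2 : k) *: 'X + 1%:P :> {poly k}.
  by rewrite -mul_polyC !rmorphN /= rmorph_nat; ring.
rewrite /negative_unipotent /=; split=> [mpE|[nsc trg]].
  have nsc : ~~ is_scalar_mx (\val g).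
    rewrite -mxminpoly_linear_is_scalar -ltnNge -ltnS -size_mxminpoly mpE.
    have -> : 'X + 1 = 'X - (-1)%:P :> {poly k} by rewrite polyCN opprK.
    by rewrite size_exp_XsubC.
  split=> //; move: mpE; rewrite mp_size // mx22_char_poly SL_det sqE.
  by move/polyP/(_ 1%N); rewrite !coefE /= !mulr1 !sub0r !addr0 => /oppr_inj.
by rewrite mp_size // mx22_char_poly SL_det sqE trg.
Qed.

(** * Which elements lie in the product *)

Lemma tr_class_prod1 (t1 t2 : k) : t1 != t2 ->
  ~ class_prod [set x : SL 2 k | tr x = t1] [set x | tr x = t2] 1%g.
Proof.
move=> /eqP t12 [x /= xt1 [y yt2 xy1]]; apply: t12; rewrite -xt1 -yt2.
have -> : y = (x^-1)%g by rewrite -[y](mulKg x) xy1 mulg1.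
by rewrite SL2_valV raddfB /= mxtrace_scalar mulr2n addrK.
Qed.

(** If x y = - I, then y = - x^-1 has trace - tr(x). The converse needs an element of trace [t1] to
    start from. *)
Lemma tr_class_prod_opp1 (t1 t2 : k) :
    (exists x : SL 2 k, tr x = t1) ->
  class_prod [set x : SL 2 k | tr x = t1] [set x | tr x = t2] (SL2_opp1 k) <->
  t1 = - t2.
Proof.
have trV x : tr (x^-1 * SL2_opp1 k)%g = - tr x.
  rewrite SL_mulE /= mulmxN mulmx1 raddfN /=; congr (- _).
  by rewrite -[invmx _]/(\val x^-1%g) SL2_valV raddfB /= mxtrace_scalar mulr2n addrK.
move=> [x0 x0t1]; split=> [[x /= xt1 [y yt2 xyN]]|t12].
  by rewrite -xt1 -yt2 -[y](mulKg x) xyN trV opprK.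
exists x0 => //; exists (x0^-1 * SL2_opp1 k)%g; last by rewrite mulKVg.
by change (tr (x0^-1 * SL2_opp1 k)%g = t2); rewrite trV x0t1 t12 opprK.
Qed.

Lemma tr_class_prod_nonscalar (t1 t2 : k) g :
    u_le2 k -> (2 : k) != 0 -> t1 != t2 -> ~~ is_scalar_mx (\val g) ->
  class_prod [set x : SL 2 k | tr x = t1] [set x | tr x = t2] g <->
  (tr g = -2 -> t1 = - t2 -> exists w : k, w ^+ 2 - t1 * w + 1 = 0).
Proof.
move=> hu n2 t12 nsc; rewrite tr_class_prodP //; split=> [|split].
  (* Here the conic equation depends only on w = p - q and reads w^2 - t1 w + 1 = 0. *)
  move=> [p [q pq]] tg t1E; exists (p - q); rewrite -[RHS]pq tg t1E; ring.
exact: conic_point.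
Qed.

End SL2.

Theorem proposition3p3 (k : fieldType)
    (hu : u_le2 k) (hqc : ~ quadratically_closed k)
    (hchar : 2%N \notin [pchar k]) (hcard : (`I_5 #<= [set: k])%card)
    (C1 C2 : set (SL 2 k))
    (hC1 : semisimple_class C1) (hC2 : semisimple_class C2) (hC12 : C1 <> C2) :
  (class_trace C1 <> - class_trace C2 ->
     class_prod C1 C2 = ~` [set 1%g; SL2_opp1 k]) /\
  (class_trace C1 = - class_trace C2 ->
     (~ (nonsplit C1 /\ nonsplit C2) ->
        class_prod C1 C2 = ~` [set 1%g]) /\
     (nonsplit C1 /\ nonsplit C2 ->
        class_prod C1 C2 = ~` ([set 1%g] `|` negative_unipotent k))).
Proof.
have n2 : (2 : k) != 0 by move: hchar; rewrite inE /=.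
have [C1E _] := semisimple_classP hu hC1; have [C2E _] := semisimple_classP hu hC2.
(* All elements of a class share the polynomial X^2 - t X + 1, so one of them decides. *)
have nsC (C : set (SL 2 k)) : semisimple_class C -> nonsplit C <->
    ~ exists w, w ^+ 2 - class_trace C * w + 1 = 0.
  move=> hC; have [CE _] := semisimple_classP hu hC.
  rewrite -irreducible_quadraticP; split=> [ns|irr x].
    have [g [_ _ Cg]] := hC.
    have gC : C g by rewrite Cg; exists 1%g; rewrite ?conjg1.
    have /= gt : [set x : SL 2 k | \tr (\val x) = class_trace C] g by rewrite -CE.
    by rewrite -gt -[X in _ + X%:P](SL_det g) -mx22_char_poly; apply: ns.
  by rewrite CE /= => xt; rewrite mx22_char_poly SL_det xt.
have nsC1 := nsC _ hC1; have {nsC} nsC2 := nsC _ hC2.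
have exC1 : exists x : SL 2 k, \tr (\val x) = class_trace C1.
  have [g [_ _ Cg]] := hC1.
  by exists g; apply/esym; rewrite Cg; apply: class_traceE; exists 1%g; rewrite ?conjg1.
have t12 : class_trace C1 != class_trace C2.
  by apply/eqP => t12; apply: hC12; rewrite C1E C2E t12.
have prod1 : ~ class_prod C1 C2 1%g by rewrite C1E C2E; apply: tr_class_prod1.
have prodN1 : class_prod C1 C2 (SL2_opp1 k) <-> class_trace C1 = - class_trace C2.
  by rewrite {1}C1E {1}C2E; apply: tr_class_prod_opp1.
have prodns g : ~~ is_scalar_mx (\val g) -> class_prod C1 C2 g <->
    (\tr (\val g) = -2 -> class_trace C1 = - class_trace C2 ->
       exists w, w ^+ 2 - class_trace C1 * w + 1 = 0).
  by rewrite {1}C1E {1}C2E; apply: tr_class_prod_nonscalar.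
have sc1 : is_scalar_mx (\val (1%g : SL 2 k)) by apply: scalar_mx_is_scalar.
have scN1 : is_scalar_mx (\val (SL2_opp1 k)).
  by apply/is_scalar_mxP; exists (- 1); rewrite rmorphN.
split=> [tN|tN]; last split=> [sp|[/nsC1 nsp _]].
- apply/seteqP; split=> [g gC [] gE|g /= gN].
  + by apply: prod1; rewrite -gE.
  + by apply: tN; apply/prodN1; rewrite -gE.
  by apply/prodns => // ; apply/negP => /SL2_scalar.
- apply/seteqP; split=> [g gC gE|g /= gN]; first by apply: prod1; rewrite -gE.
  have [/SL2_scalar[//|->]|nsc] := boolP (is_scalar_mx (\val g)).
    exact/prodN1.
  (* With opposite traces, w -> - w exchanges the roots of the two characteristic polynomials: the
     classes are split or non-split together. *)
  apply/prodns => // _ _; apply: contrapT => nr; apply: sp.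
  split; [exact/nsC1|apply/nsC2 => -[w w0]; apply: nr].
  by exists (- w); rewrite -[RHS]w0 tN; ring.
apply/seteqP; split=> [g gC [gE|/negative_unipotentP[nsc gt]]|g /= gN].
- by apply: prod1; rewrite -gE.
- by apply: nsp; apply: (prodns g nsc).1.
have [/SL2_scalar[g1|->]|nsc] := boolP (is_scalar_mx (\val g)).
- by case: gN; left.
- exact/prodN1.
by apply/prodns => // gt; case: gN; right; apply/negative_unipotentP.
Qed.
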